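(* Let $p\in\mathbb N$ and let $c_1,\dots,c_p\in\mathbb R$ be pairwise distinct. Let $B_n$ and $A^{(i)}_n$ ($i=1,\dots,p$) be the step line multiple Hermite polynomials of type II (monic) and type I defined in the context. Then $$xB_n(x)=B_{n+1}(x)+b^0_nB_n(x)+\sum_{j=1}^pb^j_nB_{n-j}(x)\quad(n\ge0),$$ $$xA^{(i)}_n(x)=A^{(i)}_{n-1}(x)+b^0_{n-1}A^{(i)}_n(x)+\sum_{j=1}^pb^j_{n+j-1}A^{(i)}_{n+j}(x)\quad(n\ge1,\ i\in\{1,\dots,p\}),$$ with the convention $B_r=0$ for $r<0$, where for $m\ge0$ and $k\in\{0,\dots,p-1\}$, $$b^0_{pm+k}=\frac{c_{k+1}}2;$$ for $j\in\{1,\dots,k\}$, $$b^j_{pm+k}=\frac1{2^j}\sum_{i=1}^{k+1-j}(m+1)\prod_{q=k+2-j}^k(c_i-c_q)+\frac1{2^j}\sum_{i=k+1}^pm\prod_{q=k+2-j}^k(c_i-c_q);$$ and for $j\in\{k+1,\dots,p\}$, $$b^j_{pm+k}=\frac1{2^j}\sum_{i=k+1}^{p+k+1-j}m\prod_{q=1}^k(c_i-c_q)\prod_{q=p+k+2-j}^p(c_i-c_q).$$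
   Context: $\mathbb N_0=\{0,1,2,\dots\}$; $|\vec n|=n_1+\cdots+n_p$; $(x)_0=1$, $(x)_n=x(x+1)\cdots(x+n-1)$; empty products equal $1$ and empty sums equal $0$; $0^0=1$. The multiple Hermite polynomials are the multiple orthogonal polynomials for the weights $e^{-x^2+c_ix}$, $i=1,\dots,p$, with respect to $dx$ on $\mathbb R$. Let $H_n(x)=\sum_{k=0}^{\lfloor n/2\rfloor}(-1)^k\frac{(-n)_{2k}}{k!}\frac{x^{n-2k}}{2^{2k}}$, $n\in\mathbb N_0$, be the usual monic Hermite polynomials (scalar index). For $\vec n=(n_1,\dots,n_p)\in\mathbb N_0^p$: Type II (monic, degree $|\vec n|$): $$H_{\vec n}(x)=\left(-\frac12\right)^{|\vec n|}\sum_{l_1=0}^{n_1}\cdots\sum_{l_p=0}^{n_p}2^{l_1+\cdots+l_p}\prod_{q=1}^p\frac{(-n_q)_{l_q}}{l_q!}c_q^{\,n_q-l_q}\;H_{l_1+\cdots+l_p}(x).$$ Type I: $H^{(i)}_{\vec n}=0$ if $n_i=0$, and if $n_i\ge1$, $$H^{(i)}_{\vec n}(x)=\frac{(-1)^{n_i-1}}{\sqrt\pi\,(n_i-1)!}\,\frac{2^{|\vec n|-1}e^{-c_i^2/4}}{\prod_{q\ne i}(c_i-c_q)^{n_q}}\sum_{\substack{l_1,\dots,l_p\ge0\\ l_1+\cdots+l_p\le n_i-1}}\frac{(-n_i+1)_{l_1+\cdots+l_p}}{l_i!}\prod_{q\ne i}\frac{(n_q)_{l_q}}{l_q!\,(c_q-c_i)^{l_q}}\,H_{n_i-1-l_1-\cdots-l_p}\left(\frac{c_i}{2}\right)x^{l_i}.$$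 Step line: for $m\ge0$, $k\in\{0,\dots,p-1\}$, let $\vec n(pm+k)$ be the multi-index whose first $k$ entries are $m+1$ and whose remaining $p-k$ entries are $m$; put $B_n=H_{\vec n(n)}$ and $A^{(i)}_n=H^{(i)}_{\vec n(n)}$ (in particular $A^{(i)}_0=0$). *)

(* Defs.v *)
From HB Require Import structures.
From mathcomp Require Import all_boot all_order all_algebra.
From mathcomp Require Import all_classical all_reals all_analysis.

Set Implicit Arguments.
Unset Strict Implicit.
Unset Printing Implicit Defensive.

Import Order.TTheory GRing.Theory Num.Theory.
Local Open Scope ring_scope.

(* Indices are 0-based throughout: c_q of the literature is [c] at the ordinal
   of value q - 1, and sums and products over q = a, ..., b become conditions
   a - 1 <= q < b on ordinals. *)

(* Rising factorial (x)_n. *)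
Definition poch (R : realType) (x : R) (n : nat) : R :=
  \prod_(k < n) (x + k%:R).

Definition hermite (R : realType) (n : nat) : {poly R} :=
  \sum_(k < n./2.+1)
    ((-1) ^+ k * (poch (- n%:R) (2 * k) / k`!%:R) / 2 ^+ (2 * k))
      *: 'X^(n - 2 * k).

(* The index types of the two sums below are larger than needed (each l_q is
   only bounded a priori by |n|, resp. n_i - 1); the filters cut them down to
   the exact ranges. *)
Definition hermite_typeII (R : realType) (p : nat) (c : 'I_p -> R)
    (n : 'I_p -> nat) : {poly R} :=
  let N := (\sum_(q < p) n q)%N in
  (- 2^-1) ^+ N *:
  \sum_(l : {ffun 'I_p -> 'I_N.+1} | [forall q, (l q <= n q)%N])
    (2 ^+ (\sum_(q < p) l q)%N *
     \prod_(q < p)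
       (poch (- (n q)%:R) (l q) / (l q)`!%:R * c q ^+ (n q - l q)))
      *: hermite R (\sum_(q < p) l q)%N.

Definition hermite_typeI (R : realType) (p : nat) (c : 'I_p -> R)
    (i : 'I_p) (n : 'I_p -> nat) : {poly R} :=
  let N := (\sum_(q < p) n q)%N in
  if n i is d.+1 then
    ((-1) ^+ d / (Num.sqrt pi * d`!%:R) *
     (2 ^+ N.-1 * expR (- (c i ^+ 2 / 4)) /
      \prod_(q < p | q != i) (c i - c q) ^+ n q)) *:
    \sum_(l : {ffun 'I_p -> 'I_d.+1} | (\sum_(q < p) l q <= d)%N)
      (poch (- d%:R) (\sum_(q < p) l q)%N / (l i)`!%:R *
       \prod_(q < p | q != i)
         (poch (n q)%:R (l q) / ((l q)`!%:R * (c q - c i) ^+ l q)) *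
       (hermite R (d - \sum_(q < p) l q)%N).[c i / 2])
        *: 'X^(l i)
  else 0.

(* For n = p m + k with k < p: k entries m + 1 followed by p - k entries m. *)
Definition step_index (p n : nat) (q : 'I_p) : nat :=
  if (q < n %% p)%N then (n %/ p).+1 else (n %/ p)%N.
Arguments step_index : clear implicits.

(* Indexed by [int] so that B_r = 0 for r < 0. *)
Definition stepB (R : realType) (p : nat) (c : 'I_p -> R) (r : int) :
    {poly R} :=
  if r is Posz n then hermite_typeII c (step_index p n) else 0.

Definition stepA (R : realType) (p : nat) (c : 'I_p -> R) (i : 'I_p)
    (n : nat) : {poly R} :=
  hermite_typeI c i (step_index p n).

(* The coefficient b^j_{pm+k}; only meaningful for j <= p. *)
Definition rec_coef_mk (R : realType) (p : nat) (c : 'I_p -> R)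
    (j m : nat) (k : 'I_p) : R :=
  if j == 0%N then c k / 2
  else if (j <= k)%N then
    1 / 2 ^+ j *
      (\sum_(i < p | (i < k + 1 - j)%N)
         (m.+1%:R * \prod_(q < p | (k + 1 - j <= q < k)%N) (c i - c q))) +
    1 / 2 ^+ j *
      (\sum_(i < p | (k <= i)%N)
         (m%:R * \prod_(q < p | (k + 1 - j <= q < k)%N) (c i - c q)))
  else
    1 / 2 ^+ j *
      (\sum_(i < p | (k <= i < p + k + 1 - j)%N)
         (m%:R * \prod_(q < p | (q < k)%N) (c i - c q)
               * \prod_(q < p | (p + k + 1 - j <= q)%N) (c i - c q))).

Definition rec_coef (R : realType) (p : nat) (hp : (0 < p)%N)
    (c : 'I_p -> R) (j n : nat) : R :=
  rec_coef_mk c j (n %/ p) (Ordinal (ltn_pmod n hp)).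

(* Main.v *)
From HB Require Import structures.
Require Import Defs.
From mathcomp Require Import all_boot all_order all_algebra.
From mathcomp Require Import all_classical all_reals all_analysis.
From mathcomp Require Import ring zify.

Set Implicit Arguments.
Unset Strict Implicit.
Unset Printing Implicit Defensive.

Import Order.TTheory GRing.Theory Num.Theory.
Local Open Scope ring_scope.

(** Both recurrences are shadows of one elementary fact about the polynomials
    P_n(y) = prod_(t < n) (y - x_t), where x_t = c_(t mod p) / 2.

    Type II.  Let Psi be the linear map with Psi(y^k) = H_k.  Expanding the
    definition gives B_n = Psi(P_n), and the three-term recurrence of the scalar
    Hermite polynomials reads X Psi(f) = Psi(y f + f' / 2)
    ([mulX_hermite_lift]).  Since y P_n = P_(n+1) + x_n P_n, all that remains is
    to expand P_n' in the Newton basis (P_M), M < n ([deriv_prod_XsubC]): the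
    coefficient of P_M is
      w(M+1, n) = sum_(t <= M) prod_(M < s < n) (x_t - x_s).
    As x is p-periodic, w vanishes as soon as its product runs over a whole
    period, so only P_(n-1), ..., P_(n-p) occur; grouping the t by their residue
    mod p identifies the coefficients with the b^j_n ([rec_coefE]).

    Type I.  Up to the factor e^(-c_i^2/4) / sqrt(pi), A_n^(i) is the residue at
    z = c_i/2 of exp(2 x (z - c_i/2) - (z^2 - c_i^2/4)) / P_n(z)
    ([stepA_coef]).  The exponential E satisfies (x - z) E = E' / 2, so an
    integration by parts turns multiplication by x into
      x / P_n  ~>  z / P_n + P_n' / (2 P_n^2),
    where z / P_n = 1 / P_(n-1) + x_(n-1) / P_n.  Dividing by z - x_t one factor
    at a time expands each 1 / ((z - x_t) P_n) in the 1 / P_(n+j), the weights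
    w(n, n+j-1) reappear, and by periodicity the expansion stops at j = p
    ([pole_jet_expand], [residue_rec]).

    The residues are taken algebraically.  With u = z - c_i/2, Laurent series in
    u are multiplied by u^M and truncated, i.e. replaced by polynomials in u
    considered modulo u^(M+1); the derivation u d/du, unlike d/du, is compatible
    with this truncation, and coefficient extraction turns it into
    multiplication by an integer, which is the integration by parts. *)

(** * Scalar Hermite polynomials *)

Lemma poch_opp_nat (R : realType) (n l : nat) :
  poch (- n%:R : R) l = (-1) ^+ l * (n ^_ l)%:R.
Proof.
elim: l => [|l IH]; first by rewrite /poch big_ord0 ffactn0 mulr1.
rewrite /poch big_ord_recr /= -/(poch _ _) IH ffactnSr natrM exprS.
have [ln|nl] := leqP l n; first by rewrite natrB //; ring.
by rewrite (ffact_small nl) !(mulr0, mul0r).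
Qed.

Lemma pochSr (R : realType) (x : R) (l : nat) :
  poch x l.+1 = poch x l * (x + l%:R).
Proof. by rewrite /poch big_ord_recr. Qed.

Lemma pochSl (R : realType) (x : R) (l : nat) :
  poch x l.+1 = x * poch (x + 1) l.
Proof.
rewrite /poch big_ord_recl /= addr0; congr (_ * _); apply: eq_bigr => k _.
by rewrite /bump /= natrD addrA.
Qed.

Definition hermite_coef (R : realType) (n k : nat) : R :=
  (-1) ^+ k * (n ^_ (2 * k))%:R / (k`!%:R * 2 ^+ (2 * k)).

Lemma fact_neq0 (R : numDomainType) (n : nat) : n`!%:R != 0 :> R.
Proof. by rewrite pnatr_eq0 -lt0n fact_gt0. Qed.

Lemma sum_ord_widen (V : nmodType) (F : nat -> V) (m n : nat) :
  (m <= n)%N -> (forall k, (m <= k)%N -> F k = 0) ->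
  \sum_(k < m) F k = \sum_(k < n) F k.
Proof.
move=> mn F0; rewrite -!(big_mkord xpredT F) [RHS](big_cat_nat (n := m)) //=.
rewrite [X in _ + X]big1_seq ?addr0 // => k /andP[_].
by rewrite mem_index_iota => /andP[mk _]; apply: F0.
Qed.

(** Beyond n / 2 the falling factorial n ^_ (2 * k) vanishes, so that Hermite
    polynomials of different degrees can be summed over a common range. *)
Lemma hermite_widen (R : realType) (n b : nat) : (n <= (2 * b).+1)%N ->
  hermite R n = \sum_(k < b.+1) hermite_coef R n k *: 'X^(n - 2 * k).
Proof.
move=> nb; rewrite /hermite.
have nb' : (n./2.+1 <= b.+1)%N by lia.
pose F k := hermite_coef R n k *: 'X^(n - 2 * k).
rewrite -(@sum_ord_widen _ F _ _ nb').
  apply: eq_bigr => k _; rewrite /F; congr (_ *: _).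
  rewrite /hermite_coef poch_opp_nat exprM sqrrN !expr1n mul1r.
  by rewrite invfM !mulrA.
move=> k nk; rewrite /F /hermite_coef ffact_small ?mulr0 ?mul0r ?scale0r //.
by lia.
Qed.

Lemma hermite_coef_rec (R : realType) (n k : nat) :
  hermite_coef R n.+2 k.+1 =
  hermite_coef R n.+1 k.+1 - n.+1%:R / 2 * hermite_coef R n k.
Proof.
have step : (n.+2 ^_ (2 * k.+1))%:R - (n.+1 ^_ (2 * k.+1))%:R
          = (2 * k.+1)%:R * n.+1%:R * (n ^_ (2 * k))%:R :> R.
  have -> : (2 * k.+1 = (2 * k).+2)%N by lia.
  rewrite (ffactSS n.+1 (2 * k).+1) (ffactnSr n.+1 (2 * k).+1) ffactSS.
  have [le|lt] := leqP (2 * k) n; last first.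
    by rewrite ffact_small // !muln0 !mulr0 subr0.
  rewrite subSS; move: (_ ^_ _) => f.
  by rewrite 4!natrM natrB //; ring.
move/(canRL (subrK _)): step => step.
rewrite /hermite_coef step factS natrM exprS.
have -> : (2 * k.+1 = (2 * k).+2)%N by lia.
rewrite !exprS natrM; field.
by rewrite fact_neq0 expf_neq0 //= -?natrM !pnatr_eq0.
Qed.

Lemma hermite0 (R : realType) : hermite R 0 = 1.
Proof.
rewrite (@hermite_widen _ 0 0) // big_ord1 /hermite_coef muln0 expr0 ffact0n.
by rewrite !expr0 !mul1r invr1 scale1r.
Qed.

Lemma hermite1 (R : realType) : hermite R 1 = 'X.
Proof.
rewrite (@hermite_widen _ 1 0) // big_ord1 /hermite_coef muln0 expr0 ffactn0.
by rewrite !expr0 !mul1r invr1 scale1r.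
Qed.

Lemma hermite_rec (R : realType) (n : nat) :
  hermite R n.+2 = 'X * hermite R n.+1 - (n.+1%:R / 2) *: hermite R n.
Proof.
rewrite (@hermite_widen _ n.+2 n.+1) ?(@hermite_widen _ n.+1 n.+1); try lia.
rewrite (@hermite_widen _ n n); last lia.
rewrite big_ord_recl [in X in 'X * X]big_ord_recl mulrDr.
rewrite -addrA; congr (_ + _).
  by rewrite -scalerAr -exprS /hermite_coef /= !ffactn0.
rewrite mulr_sumr scaler_sumr -sumrB; apply: eq_bigr => k _.
have b0 : bump 0 k = k.+1 by [].
rewrite -scalerAr scalerA /= !b0 hermite_coef_rec scalerBl.
have -> : (n.+2 - 2 * k.+1 = n - 2 * k)%N by lia.
congr (_ - _); have [le|lt] := leqP (2 * k.+1) n.+1.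
  by rewrite -exprS; congr (_ *: 'X^_); lia.
by rewrite /hermite_coef ffact_small // mulr0 mul0r !scale0r.
Qed.

(** * The type II polynomials as images of products of linear factors *)

(** The linear map Psi with Psi(y^k) = H_k. *)
Definition hermite_lift (R : realType) (f : {poly R}) : {poly R} :=
  \sum_(k < size f) f`_k *: hermite R k.

Lemma hermite_liftE (R : realType) (f : {poly R}) (N : nat) :
  (size f <= N)%N -> hermite_lift f = \sum_(k < N) f`_k *: hermite R k.
Proof.
move=> fN; rewrite /hermite_lift.
apply: (@sum_ord_widen _ (fun k => f`_k *: hermite R k)) => // k sk.
by rewrite nth_default ?scale0r.
Qed.

Lemma hermite_lift_is_linear (R : realType) : linear (@hermite_lift R).
Proof.
move=> a f g; pose N := maxn (size f) (size g).
rewrite !(@hermite_liftE _ _ N) ?leq_maxl ?leq_maxr //; last first.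
  apply: leq_trans (size_polyD _ _) _; rewrite geq_max leq_maxr andbT.
  exact: leq_trans (size_scale_leq _ _) (leq_maxl _ _).
rewrite scaler_sumr -big_split; apply: eq_bigr => k _ /=.
by rewrite coefD coefZ scalerDl scalerA.
Qed.

HB.instance Definition _ (R : realType) :=
  GRing.isLinear.Build R {poly R} {poly R} _ (@hermite_lift R)
    (@hermite_lift_is_linear R).

Lemma hermite_liftXn (R : realType) (k : nat) :
  hermite_lift 'X^k = hermite R k.
Proof.
rewrite /hermite_lift size_polyXn big_ord_recr /= coefXn eqxx scale1r.
rewrite big1 ?add0r // => j _; rewrite coefXn.
by rewrite (ltn_eqF (ltn_ord j)) scale0r.
Qed.

Lemma mulX_hermite (R : realType) (k : nat) :
  'X * hermite R k = hermite R k.+1 + (k%:R / 2) *: hermite R k.-1.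
Proof.
case: k => [|k]; first by rewrite hermite0 hermite1 mulr1 mul0r scale0r addr0.
by rewrite hermite_rec subrK.
Qed.

(** On monomials this is the three-term recurrence. *)
Lemma mulX_hermite_lift (R : realType) (f : {poly R}) :
  'X * hermite_lift f = hermite_lift ('X * f + 2^-1 *: f^`()).
Proof.
rewrite -[f]coefK poly_def.
elim/big_ind: _ => [|g h IHg IHh|k _]; last move: (f`_k) => a.
- by rewrite deriv0 mulr0 scaler0 addr0 linear0 mulr0.
- rewrite linearD /= mulrDr IHg IHh -linearD derivD scalerDr /= mulrDr.
  by rewrite addrACA.
have -> : 'X * (a *: 'X^k) + 2^-1 *: (a *: 'X^k)^`() =
          a *: ('X^(k.+1) + (k%:R / 2) *: 'X^(k.-1)).
  rewrite derivZ derivXn -scalerAr -exprS scalerDr; congr (_ + _).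
  by rewrite -[_ *+ k]scaler_nat !scalerA; congr (_ *: _); ring.
rewrite !linearZ /= linearD linearZ /= !hermite_liftXn.
by rewrite -scalerAr mulX_hermite.
Qed.

(** Binomial expansion over a range independent of n, so that a product of such
    powers can be distributed over functions with a single codomain. *)
Lemma expr_XsubC_widen (R : realType) (a : R) (n N : nat) : (n <= N)%N ->
  ('X - a%:P) ^+ n =
  \sum_(l < N.+1) ('C(n, l)%:R * (- a) ^+ (n - l)) *: 'X^l.
Proof.
move=> nN; rewrite addrC -polyCN exprDn.
pose F l : {poly R} := ('C(n, l)%:R * (- a) ^+ (n - l)) *: 'X^l.
have nN' : (n.+1 <= N.+1)%N by [].
rewrite -(@sum_ord_widen _ F _ _ nN').
  apply: eq_bigr => l _; rewrite /F -mul_polyC polyCM polyC_exp.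
  by rewrite mulrAC -mulr_natl polyC_natr mulrAC mulrA.
by move=> l nl; rewrite /F bin_small // mul0r scale0r.
Qed.

Lemma hermite_typeII_lift (R : realType) (p : nat) (c : 'I_p -> R)
    (n : 'I_p -> nat) :
  hermite_typeII c n =
  hermite_lift (\prod_(q < p) ('X - (c q / 2)%:P) ^+ n q).
Proof.
rewrite /hermite_typeII; set N := (\sum_(q < p) n q)%N.
have nN q : (n q <= N)%N by rewrite /N (bigD1 q) //= leq_addr.
under [in RHS]eq_bigr => q _ do rewrite (expr_XsubC_widen _ (nN q)).
rewrite bigA_distr_bigA /= scaler_sumr linear_sum big_mkcond /=.
apply: eq_bigr => l _.
rewrite scaler_prod prodrXr [RHS]linearZ /= hermite_liftXn.
case: ifPn => [/forallP ln|]; last first.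
  rewrite negb_forall => /existsP[q]; rewrite -ltnNge => nl.
  by rewrite (bigD1 q) //= bin_small // !mul0r scale0r.
rewrite scalerA; congr (_ *: _).
rewrite /N -!prodrXr -!big_split /=; apply: eq_bigr => q _.
rewrite poch_opp_nat -bin_ffact natrM mulrA mulfK ?fact_neq0 //.
rewrite -[in X in X * _](subnK (ln q)) exprD.
have -> : - (c q / 2) = - 2^-1 * c q by ring.
rewrite [in RHS]exprMn.
(* The two signs and the two powers of 2 attached to l_q cancel. *)
have e : (- 2^-1) ^+ l q * 2 ^+ l q * (-1) ^+ l q = 1 :> R.
  by rewrite -!exprMn mulrN1 mulNr opprK mulVf ?expr1n // pnatr_eq0.
by rewrite -[RHS]mulr1 -[X in _ = _ * X]e; ring.
Qed.

(** * Step-line indices and residues modulo p *)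

Definition cyclic_index (p : nat) (hp : (0 < p)%N) (t : nat) : 'I_p :=
  Ordinal (ltn_pmod t hp).

Lemma cyclic_index_small (p : nat) (hp : (0 < p)%N) (q : 'I_p) :
  cyclic_index hp q = q.
Proof. by apply/val_inj; rewrite /= modn_small. Qed.

Lemma cyclic_indexDM (p : nat) (hp : (0 < p)%N) (m t : nat) :
  cyclic_index hp (m * p + t) = cyclic_index hp t.
Proof. by apply/val_inj; rewrite /= modnMDl. Qed.

(** Both ends of a block are covered: for r = p the formula agrees with the one
    for m + 1 and r = 0. *)
Lemma step_indexE (p m r : nat) (q : 'I_p) : (r <= p)%N ->
  step_index p (m * p + r) q = (m + (q < r))%N.
Proof.
move=> rp; have qp := ltn_ord q; have hp : (0 < p)%N by apply: leq_trans qp.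
rewrite /step_index modnMDl divnMDl //.
move: rp; rewrite leq_eqVlt => /orP[/eqP-> | rp].
  by rewrite modnn divnn hp ltn0 qp.
rewrite modn_small // divn_small // addn0.
by case: (q < r)%N; rewrite ?addn1 ?addn0.
Qed.

Lemma step_index0 (p : nat) (q : 'I_p) : step_index p 0 q = 0%N.
Proof. exact: (@step_indexE p 0 0 q). Qed.

(** Hence [step_index p n q] counts the t < n congruent to q mod p, which is
    what turns products over t < n into products of powers over q. *)
Lemma step_indexS (p : nat) (hp : (0 < p)%N) (n : nat) (q : 'I_p) :
  step_index p n.+1 q = (step_index p n q + (q == cyclic_index hp n))%N.
Proof.
have rp := ltn_pmod n hp.
have -> : (q == cyclic_index hp n) = (q == n %% p :> nat)%N by [].
rewrite [in LHS](divn_eq n p) [in RHS](divn_eq n p) modnMDl modn_mod.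
rewrite -addnS !step_indexE //; last exact: ltnW.
by rewrite -addnA ltnS leq_eqVlt; case: ltngtP.
Qed.

Lemma sum_cyclic_index (p : nat) (hp : (0 < p)%N) (V : nmodType)
    (F : 'I_p -> V) (n : nat) :
  \sum_(t < n) F (cyclic_index hp t) = \sum_(q < p) F q *+ step_index p n q.
Proof.
elim: n => [|n IH].
  by rewrite big_ord0 big1 // => q _; rewrite step_index0.
rewrite big_ord_recr /= IH; under [RHS]eq_bigr => q _ do
  rewrite (step_indexS hp) mulrnDr.
rewrite big_split /=; congr (_ + _).
rewrite (bigD1 (cyclic_index hp n)) //= eqxx mulr1n big1 ?addr0 // => q.
by move/negbTE->.
Qed.

Lemma prod_cyclic_index (p : nat) (hp : (0 < p)%N) (S : comPzSemiRingType)
    (F : 'I_p -> S) (n : nat) :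
  \prod_(t < n) F (cyclic_index hp t) = \prod_(q < p) F q ^+ step_index p n q.
Proof.
elim: n => [|n IH].
  by rewrite big_ord0 big1 // => q _; rewrite step_index0.
rewrite big_ord_recr /= IH; under [RHS]eq_bigr => q _ do
  rewrite (step_indexS hp) exprD.
rewrite big_split /=; congr (_ * _).
rewrite (bigD1 (cyclic_index hp n)) //= eqxx expr1 big1 ?mulr1 // => q.
by move/negbTE->.
Qed.

Lemma prod_cyclic_index_block (p : nat) (hp : (0 < p)%N) (S : comPzSemiRingType)
    (F : 'I_p -> S) (m a b : nat) : (b <= p)%N ->
  \prod_(m * p + a <= s < m * p + b) F (cyclic_index hp s) =
  \prod_(q < p | (a <= q < b)%N) F q.
Proof.
move=> bp; rewrite addnC big_addn addKn.
under eq_bigr => s _ do rewrite addnC cyclic_indexDM.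
rewrite (big_nat_widenl a 0) // (big_nat_widen _ b p) //=.
rewrite (big_mkord (fun s => (a <= s < b)%N) (fun s => F (cyclic_index hp s))).
by apply: eq_bigr => q _; rewrite cyclic_index_small.
Qed.

(** * Newton expansion of a logarithmic derivative *)

(** The coefficient of P_(M-1) in the expansion of P_N', and also that of
    1 / P_(N+1) in the expansion of P_M' / P_M^2, where P_n is the product of the
    y - x_t over t < n. *)
Definition newton_weight (S : comNzRingType) (x : nat -> S) (M N : nat) : S :=
  \sum_(t < M) \prod_(M <= s < N) (x t - x s).

(** P_n' is the sum over t < n of the quotients Q_t = P_n / (y - x_t), and each
    quotient obeys Q_t(n+1) = P_n + (x_t - x_n) Q_t(n), because
    y - x_n = (y - x_t) + (x_t - x_n). *)
Lemma deriv_prod_XsubC (R : comNzRingType) (x : nat -> R) (n : nat) :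
  (\prod_(t < n) ('X - (x t)%:P))^`() =
  \sum_(M < n) newton_weight x M.+1 n *: \prod_(t < M) ('X - (x t)%:P).
Proof.
pose P M : {poly R} := \prod_(t < M) ('X - (x t)%:P).
pose Q t n : {poly R} :=
  \sum_(M < n | (t <= M)%N) (\prod_(M.+1 <= s < n) (x t - x s)) *: P M.
have QS t N : (t <= N)%N -> Q t N.+1 = P N + (x t - x N) *: Q t N.
  move=> tN; rewrite /Q big_mkcond big_ord_recr /= tN big_geq // scale1r addrC.
  congr (_ + _); rewrite -big_mkcond scaler_sumr; apply: eq_bigr => M _.
  by rewrite scalerA big_nat_recr // mulrC.
have QNN N : Q N N = 0 by rewrite /Q big_pred0 // => M; rewrite leqNgt ltn_ord.
have XQ t N : (t < N)%N -> ('X - (x t)%:P) * Q t N = P N.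
  elim: N => // N IH; rewrite ltnS leq_eqVlt => /orP[/eqP->|tN].
    by rewrite QS // QNN scaler0 addr0 mulrC /P big_ord_recr.
  rewrite QS ?(ltnW tN) // mulrDr -scalerAr IH // -mul_polyC -mulrDl polyCB.
  by rewrite addrA subrK mulrC /P big_ord_recr.
transitivity (\sum_(t < n) Q t n); last first.
  rewrite (exchange_big_dep xpredT) //=; apply: eq_bigr => M _.
  rewrite /newton_weight
    (big_ord_widen n (fun t => \prod_(M.+1 <= s < n) (x t - x s)) (ltn_ord M)).
  rewrite scaler_suml.
  exact: eq_bigl.
elim: n => [|N IH]; first by rewrite !big_ord0 derivC.
rewrite big_ord_recr /= derivM IH derivXsubC mulr1 big_ord_recr /=.
rewrite [Q N _]QS // QNN scaler0 addr0; congr (_ + _).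
rewrite mulr_suml; apply: eq_bigr => t _.
rewrite QS ?(ltnW (ltn_ord t)) // -(XQ _ _ (ltn_ord t)) -mul_polyC polyCB.
ring.
Qed.

(** * The recurrence coefficients as Newton weights *)

Section StepLine.

Variables (R : realType) (p : nat) (hp : (0 < p)%N) (c : 'I_p -> R).

Definition node (t : nat) : R := c (cyclic_index hp t) / 2.

Lemma newton_weight_node (M N : nat) :
  newton_weight node M N =
  \sum_(q < p) (step_index p M q)%:R *
    ((2 ^+ (N - M))^-1 * \prod_(M <= s < N) (c q - c (cyclic_index hp s))).
Proof.
pose F q : R := \prod_(M <= s < N) (c q / 2 - node s).
rewrite /newton_weight (sum_cyclic_index hp F); apply: eq_bigr => q _.
rewrite -[LHS]mulr_natl /F; congr (_ * _).
under eq_bigr => s _ do rewrite /node -mulrBl mulrC.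
by rewrite big_split /= prodr_const_nat exprVn.
Qed.

Lemma cyclic_index_window (M : nat) (q : 'I_p) :
  exists2 s, (M <= s < M + p)%N & cyclic_index hp s = q.
Proof.
exists (M + (q + p - M %% p) %% p)%N.
  by rewrite leq_addr ltn_add2l ltn_pmod.
apply/val_inj => /=; rewrite modnDmr -modnDml addnC subnK; last first.
  by apply: leq_trans (ltnW (ltn_pmod M hp)) _; rewrite leq_addl.
by rewrite modnDr modn_small.
Qed.

(** A window of length p meets every residue, in particular that of t. *)
Lemma prod_node_wide (t M N : nat) : (M + p <= N)%N ->
  \prod_(M <= s < N) (node t - node s) = 0.
Proof.
move=> MN; have [s sM sq] := cyclic_index_window M (cyclic_index hp t).
rewrite (big_cat_nat (n := s)) //=; try lia.
rewrite [X in _ * X]big_ltn; last lia.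
by rewrite /node sq subrr mul0r mulr0.
Qed.

Lemma newton_weight_wide (M N : nat) : (M + p <= N)%N ->
  newton_weight node M N = 0.
Proof. by move=> MN; apply: big1 => t _; apply: prod_node_wide. Qed.

(** Grouping t < N + 1 - j by its residue q gives the factor m or m + 1, and the
    window of length j - 1 below N = p m + k consists of the residues
    k + 1 - j, ..., k - 1, or, once it crosses p m, of 0, ..., k - 1 together with
    p + k + 1 - j, ..., p - 1.  The residues q missing from the sums defining the
    coefficient are those in the window, where the product is zero.  For m = 0
    and k < j both sides vanish. *)
Lemma rec_coefE (j N : nat) : (1 <= j <= p)%N ->
  rec_coef hp c j N = 2^-1 * newton_weight node (N.+1 - j) N.
Proof.
case: j => // j /= jp; rewrite subSS newton_weight_node.
have kp := ltn_pmod N hp; move Dm : (N %/ p)%N => m.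
rewrite /rec_coef Dm /rec_coef_mk /=.
have DN : N = (m * p + N %% p)%N by rewrite -Dm -divn_eq.
move: (N %% p)%N kp DN => k kp ->; rewrite addn1 subSS.
have two0 : (2 : R) != 0 by rewrite pnatr_eq0.
have blk n a b q : (b <= p)%N ->
    \prod_(n * p + a <= s < n * p + b) (c q - c (cyclic_index hp s)) =
    \prod_(r < p | (a <= r < b)%N) (c q - c r).
  exact: (prod_cyclic_index_block hp (fun r => c q - c r)).
have [jk|kj] := ltnP j k.
  have -> : (m * p + k - j = m * p + (k - j))%N by lia.
  rewrite subnDl.
  under [in RHS]eq_bigr => q _ do
    rewrite blk ?(ltnW kp) //
      step_indexE ?(leq_trans (leq_subr _ _) (ltnW kp)) //.
  rewrite subKn ?(ltnW jk) // -mulrDr.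
  rewrite [in LHS]big_mkcond [X in _ * (_ + X)]big_mkcond.
  rewrite -big_split /= !mulr_sumr; apply: eq_bigr => q _.
  have [qj|jq] := ltnP q (k - j).
    rewrite leqNgt (leq_trans qj) ?leq_subr //= addn1 addr0.
    by rewrite exprS; field; rewrite expf_neq0.
  have [kq|qk] := leqP k q.
    by rewrite add0r addn0 exprS; field; rewrite expf_neq0.
  by rewrite (bigD1 q) ?jq //= subrr; ring.
have -> : (p + k + 1 - j.+1 = p + k - j)%N by lia.
case: m {Dm} => [|m].
  rewrite mul0n add0n (_ : k - j = 0)%N; last lia.
  rewrite [X in _ = _ * X]big1 ?mulr0 => [|q _]; last first.
    by rewrite step_index0 mul0r.
  by rewrite big1 ?mulr0 // => q _; rewrite !mul0r.
have M_eq : (m.+1 * p + k - j = m * p + (p + k - j))%N by lia.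
rewrite M_eq !mulr_sumr big_mkcond; apply: eq_bigr => q _ /=.
have qp := ltn_ord q.
(* The window starts in the block of index m and ends in the next one. *)
rewrite (big_cat_nat (n := (m * p + p)%N)) //=; try lia.
have -> : (m * p + p = m.+1 * p + 0)%N by lia.
rewrite blk ?(ltnW kp) //.
have -> : (m.+1 * p + 0 = m * p + p)%N by lia.
rewrite blk // step_indexE; last lia.
have [qk|kq] /= := ltnP q k.
  by rewrite [X in _ = _ * (_ * (_ * (_ * X)))](bigD1 q) ?qk //= subrr; ring.
have [qj|jq] /= := ltnP q (p + k - j).
  rewrite addn1 (_ : m.+1 * p + k - (m * p + (p + k - j)) = j)%N; last lia.
  rewrite exprS; under [in RHS]eq_bigl => r do rewrite ltn_ord andbT.
  by field; rewrite expf_neq0.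
by rewrite [X in _ = _ * (_ * (_ * (X * _)))](bigD1 q) ?jq ?qp //= subrr; ring.
Qed.

End StepLine.

(** * The type II recurrence *)

Section TypeII.

Variables (R : realType) (p : nat) (hp : (0 < p)%N) (c : 'I_p -> R).

Lemma stepB_lift (n : nat) :
  stepB c n = hermite_lift (\prod_(t < n) ('X - (node hp c t)%:P)).
Proof.
by rewrite /stepB hermite_typeII_lift
  (prod_cyclic_index hp (fun q => 'X - (c q / 2)%:P)).
Qed.

Lemma rec_coef0 (n : nat) : rec_coef hp c 0 n = node hp c n.
Proof. by []. Qed.

Lemma stepB_rec (n : nat) :
  'X * stepB c n%:Z =
    stepB c (n%:Z + 1) + rec_coef hp c 0 n *: stepB c n%:Z
    + \sum_(1 <= j < p.+1) rec_coef hp c j n *: stepB c (n%:Z - j%:Z).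
Proof.
pose P M : {poly R} := \prod_(t < M) ('X - (node hp c t)%:P).
have BP (M : nat) : stepB c M = hermite_lift (P M) by exact: stepB_lift.
have -> : n%:Z + 1 = n.+1%:Z by lia.
rewrite !BP mulX_hermite_lift rec_coef0.
have -> : 'X * P n = P n.+1 + node hp c n *: P n.
  rewrite /P big_ord_recr /= -mul_polyC; ring.
rewrite !linearD !linearZ /=; congr (_ + _).
rewrite deriv_prod_XsubC [hermite_lift (\sum_(i < _) _)]linear_sum scaler_sumr.
(* Both sums are partial sums of T: it vanishes for j >= p by periodicity, and
   for j >= n because the index of B is negative. *)
pose T j := 2^-1 *: (newton_weight (node hp c) (n - j) n *:
  stepB c (n%:Z - j.+1%:Z)).
have -> : \sum_(1 <= j < p.+1) rec_coef hp c j n *: stepB c (n%:Z - j%:Z)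
        = \sum_(j < p) T j.
  rewrite big_add1 big_mkord; apply: eq_bigr => j _.
  by rewrite rec_coefE ?ltn_ord // /T scalerA.
have -> : \sum_(M < n)
            2^-1 *: hermite_lift (newton_weight (node hp c) M.+1 n *: P M)
        = \sum_(j < n) T j.
  rewrite (reindex_inj rev_ord_inj) /=; apply: eq_bigr => j _.
  rewrite linearZ /= -BP /T; congr (_ *: (_ *: stepB c _)).
    by rewrite subnSK.
  by have := ltn_ord j; lia.
rewrite (@sum_ord_widen _ T p (maxn p n)) ?leq_maxl //; last first.
  move=> j pj; rewrite /T; have [jn|nj] := ltnP j n.
    by rewrite newton_weight_wide ?scale0r ?scaler0 //; lia.
  have [m ->] : exists m, n%:Z - j.+1%:Z = Negz m by exists (j - n)%N; lia.
  by rewrite !scaler0.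
rewrite (@sum_ord_widen _ T n (maxn p n)) ?leq_maxr // => j nj; rewrite /T.
have [m ->] : exists m, n%:Z - j.+1%:Z = Negz m by exists (j - n)%N; lia.
by rewrite !scaler0.
Qed.

End TypeII.

(** * Truncated power series *)

(** Congruence modulo the K-th power of the variable. *)
Definition jet_eq (S : comNzRingType) (K : nat) (f g : {poly S}) : Prop :=
  forall k, (k < K)%N -> f`_k = g`_k.

Section Jets.

Variables (S : comNzRingType) (K : nat).
Implicit Types f g h : {poly S}.

Lemma jet_refl f : jet_eq K f f. Proof. by []. Qed.

Lemma jet_of_eq f g : f = g -> jet_eq K f g. Proof. by move->. Qed.

Lemma jet_sym f g : jet_eq K f g -> jet_eq K g f.
Proof. by move=> fg k kK; rewrite fg. Qed.

Lemma jet_trans f g h : jet_eq K f g -> jet_eq K g h -> jet_eq K f h.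
Proof. by move=> fg gh k kK; rewrite fg ?gh. Qed.

Lemma jetD f f' g g' :
  jet_eq K f f' -> jet_eq K g g' -> jet_eq K (f + g) (f' + g').
Proof. by move=> ff gg k kK; rewrite !coefD ff ?gg. Qed.

Lemma jetM f f' g g' :
  jet_eq K f f' -> jet_eq K g g' -> jet_eq K (f * g) (f' * g').
Proof.
move=> ff gg k kK; rewrite !coefM; apply: eq_bigr => j _.
by rewrite ff ?gg //; have := ltn_ord j; lia.
Qed.

Lemma jet_prod (I : Type) (r : seq I) (P : pred I) (F G : I -> {poly S}) :
  (forall i, P i -> jet_eq K (F i) (G i)) ->
  jet_eq K (\prod_(i <- r | P i) F i) (\prod_(i <- r | P i) G i).
Proof.
move=> FG; elim/big_rec2: _ => [|i f g Pi fg]; first exact: jet_refl.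
by apply: jetM => //; apply: FG.
Qed.

Lemma jet_sum (I : Type) (r : seq I) (P : pred I) (F G : I -> {poly S}) :
  (forall i, P i -> jet_eq K (F i) (G i)) ->
  jet_eq K (\sum_(i <- r | P i) F i) (\sum_(i <- r | P i) G i).
Proof.
move=> FG; elim/big_rec2: _ => [|i f g Pi fg]; first exact: jet_refl.
by apply: jetD => //; apply: FG.
Qed.

(** The Euler operator u d/du.  Unlike d/du it preserves the order of
    truncation. *)
Definition euler f : {poly S} := 'X * f^`().

Lemma coef_euler f k : (euler f)`_k = f`_k *+ k.
Proof. by rewrite /euler coefXM; case: k => // k; rewrite coef_deriv. Qed.

Lemma eulerM f g : euler (f * g) = euler f * g + f * euler g.
Proof. by rewrite /euler derivM; ring. Qed.

Lemma eulerXn n : euler 'X^n = 'X^n *+ n.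
Proof.
apply/polyP => k; rewrite coef_euler coefMn coefXn.
by case: eqP => [->|]; rewrite ?mul0rn.
Qed.

Lemma jet_euler f g : jet_eq K f g -> jet_eq K (euler f) (euler g).
Proof. by move=> fg k kK; rewrite !coef_euler fg. Qed.

End Jets.

#[export] Instance jet_equiv (S : comNzRingType) K :
  RelationClasses.Equivalence (@jet_eq S K).
Proof. split; [exact: jet_refl|exact: jet_sym|exact: jet_trans]. Qed.

#[export] Instance jet_add_proper (S : comNzRingType) K :
  Morphisms.Proper
    (Morphisms.respectful (@jet_eq S K)
      (Morphisms.respectful (@jet_eq S K) (@jet_eq S K)))
    (@GRing.add {poly S}).
Proof. by move=> f f' ff g g' gg; apply: jetD. Qed.

#[export] Instance jet_mul_proper (S : comNzRingType) K :
  Morphisms.Proper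
    (Morphisms.respectful (@jet_eq S K)
      (Morphisms.respectful (@jet_eq S K) (@jet_eq S K)))
    (@GRing.mul {poly S}).
Proof. by move=> f f' ff g g' gg; apply: jetM. Qed.


(** * Residues of E / P_n and their recurrence *)

(** The variable of the polynomials is u = z - al, so V_t stands for z - x_t.
    The predicate [hit] singles out the factors with x_t = al, which are u
    itself, and I_t is a truncated inverse of V_t for the other t. *)
Section Residue.

Variables (S : comNzRingType) (M : nat).
Variables (x : nat -> S) (al : S) (hit : pred nat) (I : nat -> {poly S}).

Let V t : {poly S} := 'X + (al - x t)%:P.

Hypothesis hitP : forall t, hit t -> x t = al.
Hypothesis invP : forall t, ~~ hit t -> jet_eq M.+1 (V t * I t) 1.

Let L n : {poly S} := \prod_(t < n | ~~ hit t) I t.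
Let hits n : nat := (\sum_(t < n) hit t)%N.

(** The power series u^M / P_n; the residue of E / P_n is the coefficient of
    u^(M-1) in E times this series. *)
Definition pole_jet (n : nat) : {poly S} := 'X^(M - hits n) * L n.
Local Notation J := pole_jet.

(* u / V_t *)
Let Y t : {poly S} := if hit t then 1 else 'X * I t.

Let hitsS n : hits n.+1 = (hits n + hit n)%N.
Proof. by rewrite /hits big_ord_recr. Qed.

Let LS n : L n.+1 = if hit n then L n else L n * I n.
Proof.
by rewrite /L big_mkcond big_ord_recr -big_mkcond /=; case: hit; rewrite ?mulr1.
Qed.

Lemma pole_jetS n : (hits n.+1 <= M)%N -> jet_eq M.+1 (J n) (V n * J n.+1).
Proof.
rewrite /pole_jet hitsS LS; case: ifPn => [hn|hn] hM.
  have -> : V n = 'X by rewrite /V hitP // subrr addr0.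
  have -> : (M - hits n = (M - (hits n + true)).+1)%N by lia.
  by rewrite exprS !mulrA.
rewrite addn0.
have -> : V n * ('X^(M - hits n) * (L n * I n)) =
          'X^(M - hits n) * L n * (V n * I n) by ring.
by rewrite (invP hn) mulr1.
Qed.

Lemma factor_jet t : jet_eq M.+1 (V t * Y t) 'X.
Proof.
rewrite /Y; case: ifPn => [ht|ht].
  by rewrite mulr1 /V hitP // subrr addr0.
by rewrite mulrCA (invP ht) mulr1.
Qed.

(* Obtained by applying u d/du to V_t I_t = 1. *)
Let euler_inv t : ~~ hit t -> jet_eq M.+1 (euler (I t)) (- ('X * I t) * I t).
Proof.
move=> ht; have VI := invP ht.
have e : jet_eq M.+1 ('X * I t + V t * euler (I t)) 0.
  have <- : euler (1 : {poly S}) = 0 by rewrite /euler derivC mulr0.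
  rewrite -(jet_euler VI) eulerM; apply: jetD => //.
  by rewrite /euler /V derivD derivX derivC addr0 mulr1.
have -> : euler (I t) = (1 - V t * I t) * euler (I t)
   + ('X * I t + V t * euler (I t)) * I t - 'X * I t * I t by ring.
rewrite e mul0r addr0 mulNr; rewrite -[X in jet_eq _ _ X]add0r.
apply: jetD => //.
have -> : 1 - V t * I t = 1 + (-1) * (V t * I t) by ring.
by rewrite VI mulN1r subrr mul0r.
Qed.

Let euler_L n :
  jet_eq M.+1 (euler (L n)) (- (\sum_(t < n | ~~ hit t) 'X * I t) * L n).
Proof.
elim: n => [|n IH].
  by rewrite /L !big_ord0 /euler derivC mulr0 oppr0 mul0r.
rewrite LS [X in - X]big_mkcond big_ord_recr -big_mkcond /=.
case: ifPn => [hn|hn] /=; first by rewrite addr0.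
rewrite eulerM IH (euler_inv hn); apply: jet_of_eq; ring.
Qed.

(** For J = u^M / P_n the left side is - u^(M+1) (1 / P_n)', that is
    u^M / P_n times u P_n' / P_n, and u P_n' / P_n is the sum of the u / V_t. *)
Lemma pole_jet_euler n : (hits n <= M)%N ->
  jet_eq M.+1 (J n *+ M - euler (J n)) ((\sum_(t < n) Y t) * J n).
Proof.
move=> nM.
have -> : \sum_(t < n) Y t = (hits n)%:R + \sum_(t < n | ~~ hit t) 'X * I t.
  rewrite /hits natr_sum [X in _ + X]big_mkcond -big_split /=.
  apply: eq_bigr => t _.
  by rewrite /Y; case: hit; rewrite ?addr0 ?add0r.
rewrite /pole_jet eulerM eulerXn.
have -> : 'X^(M - hits n) * L n *+ M = 'X^(M - hits n) * L n *+ (M - hits n)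
   + 'X^(M - hits n) * L n * (hits n)%:R.
  by rewrite mulr_natr -mulrnDr subnK.
have -> : forall a b c d : {poly S}, a + b - (c + d) = (a - c) + (b + (-1) * d).
  by move=> *; ring.
rewrite mulrnAl subrr add0r (euler_L n); apply: jet_of_eq; ring.
Qed.

(** The substitute for partial fractions: from
    1 / P_s = V_s / P_(s+1) and V_s = V_t + (x_t - x_s) one gets
    1 / (V_t P_s) = 1 / P_(s+1) + (x_t - x_s) / (V_t P_(s+1)),
    and this is iterated m times. *)
Lemma pole_jet_expand t n m : (hits (n + m) <= M)%N ->
  jet_eq M.+1 (Y t * J n)
    (\sum_(j < m) (\prod_(n <= s < n + j) (x t - x s))%:P * ('X * J (n + j).+1)
     + (\prod_(n <= s < n + m) (x t - x s))%:P * (Y t * J (n + m))).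
Proof.
elim: m => [|m IH] hM.
  by rewrite addn0 big_ord0 big_geq // add0r mul1r.
have hM' : (hits (n + m) <= M)%N.
  by apply: leq_trans hM; rewrite addnS hitsS leq_addr.
rewrite (IH hM') big_ord_recr /= -addrA; apply: jetD => //.
rewrite addnS in hM *; rewrite (pole_jetS hM) big_nat_recr ?leq_addr //=.
have -> : V (n + m) = V t + (x t - x (n + m))%:P.
  by rewrite /V -addrA -polyCD; congr (_ + _%:P); ring.
have -> : forall a, a * (Y t * ((V t + (x t - x (n + m))%:P) * J (n + m).+1))
   = a * (V t * Y t * J (n + m).+1)
   + a * (x t - x (n + m))%:P * (Y t * J (n + m).+1).
  by move=> a; ring.
by rewrite (factor_jet t) polyCM.
Qed.

(* E stands for exp (2 xi z - z^2) up to a constant factor, characterized by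
   its differential equation E' = 2 (xi - z) E. *)
Variables (E : {poly S}) (xi : S).
Hypothesis eulerE :
  jet_eq M.+1 (euler E) ('X * ((2 * (xi - al))%:P - 2 * 'X) * E).

(* The residue of E / P_n; the extra factor 'X makes the index M valid also
   for M = 0. *)
Let a n : S := ('X * E * J n)`_M.

Let hits_mono m n : (m <= n)%N -> (hits m <= hits n)%N.
Proof.
by move/subnKC<-; elim: (n - m)%N => [|k IH]; rewrite ?addn0 // addnS hitsS
  (leq_trans IH) ?leq_addr.
Qed.

(** The coefficient of u^M in (u E') J_n is computed in two ways: by parts, the
    total derivative u d/du (E J_n) contributing M times the coefficient of
    E J_n, and by the differential equation of E. *)
Lemma residue_rec (n p : nat) : (hits (n.+1 + p) <= M)%N ->
  (forall t, \prod_(n.+1 <= s < n.+1 + p) (x t - x s) = 0) ->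
  2 * xi * a n.+1 = 2 * (a n + x n * a n.+1)
    + \sum_(j < p) newton_weight x n.+1 (n.+1 + j) * a (n.+1 + j).+1.
Proof.
move=> hM x0.
have hM1 : (hits n.+1 <= M)%N.
  by apply: leq_trans (hits_mono _) hM; rewrite leq_addr.
have Jexp : jet_eq M.+1 (J n.+1 *+ M - euler (J n.+1))
    (\sum_(j < p) (newton_weight x n.+1 (n.+1 + j))%:P *
       ('X * J (n.+1 + j).+1)).
  rewrite (pole_jet_euler hM1) mulr_suml.
  have -> : \sum_(j < p) (newton_weight x n.+1 (n.+1 + j))%:P *
      ('X * J (n.+1 + j).+1)
    = \sum_(t < n.+1) \sum_(j < p)
       (\prod_(n.+1 <= s < n.+1 + j) (x t - x s))%:P * ('X * J (n.+1 + j).+1).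
    rewrite exchange_big /=; apply: eq_bigr => j _.
    by rewrite /newton_weight rmorph_sum mulr_suml.
  apply: jet_sum => t _; rewrite (pole_jet_expand t hM) x0 mul0r addr0.
  exact: jet_refl.
have eq1 : (euler E * J n.+1)`_M
         = \sum_(j < p) newton_weight x n.+1 (n.+1 + j) * a (n.+1 + j).+1.
  have -> : euler E * J n.+1 = euler (E * J n.+1) - E * euler (J n.+1).
    by rewrite eulerM addrK.
  rewrite coefB coef_euler -coefMn -coefB -mulrnAr -mulrBr.
  have EJ := jetM (@jet_refl _ M.+1 E) Jexp.
  rewrite (EJ M) // mulr_sumr coef_sum; apply: eq_bigr => j _.
  by rewrite -coefCM /a; congr (nth 0 (polyseq _) M); ring.
have eq2 : (euler E * J n.+1)`_M = 2 * xi * a n.+1 - 2 * (a n + x n * a n.+1).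
  have JS := pole_jetS hM1.
  have : jet_eq M.+1 (euler E * J n.+1)
    ((2 * xi)%:P * ('X * E * J n.+1)
     + (-2)%:P * ('X * E * J n + (x n)%:P * ('X * E * J n.+1))).
    rewrite eulerE JS; apply: jet_of_eq.
    by rewrite /V !(polyCD, polyCM, polyCN, polyC_natr, polyCB); ring.
  by move=> /(_ M (ltnSn M)) ->; rewrite coefD !coefCM coefD coefCM /a; ring.
by rewrite -eq1 eq2; ring.
Qed.

End Residue.

(** * The explicit series entering the type I polynomials *)

Section ExplicitJets.

Variables (R : realType) (K : nat).

(** (u + a)^(-n), by the binomial series. *)
Definition inv_jet (a : R) (n : nat) : {poly {poly R}} :=
  \poly_(l < K) ((-1) ^+ l * poch n%:R l / l`!%:R / a ^+ (n + l))%:P.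

Lemma inv_jetS (a : R) (n : nat) : a != 0 ->
  jet_eq K (('X + a%:P%:P) * inv_jet a n.+1) (inv_jet a n).
Proof.
move=> a0 k kK; rewrite mulrDl coefD coefXM coefCM !coef_poly kK.
case: k kK => [|k] kK /=.
  rewrite add0r -polyCM; congr (_%:P); rewrite /poch !big_ord0 !addn0 exprS.
  by field; rewrite a0 fact_neq0 expf_neq0.
rewrite (ltnW kK) -polyCM -polyCD; congr (_%:P).
rewrite pochSr pochSl -natr1 factS natrM !addnS !addSn !exprS.
by field; rewrite a0 expf_neq0 // fact_neq0 nat1r pnatr_eq0.
Qed.

Lemma inv_jet0 (a : R) : jet_eq K (inv_jet a 0) 1.
Proof.
move=> k kK; rewrite coef_poly kK coef1.
case: k kK => [|k] kK; last by rewrite pochSl mul0r mulr0 !mul0r.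
by rewrite /poch big_ord0 expr0 !mul1r !invr1 mul1r.
Qed.

Lemma inv_jet1 (a : R) : a != 0 -> jet_eq K (('X + a%:P%:P) * inv_jet a 1) 1.
Proof. by move=> a0; rewrite (inv_jetS 0 a0); apply: inv_jet0. Qed.

Lemma inv_jet_exp (a : R) (n : nat) : a != 0 ->
  jet_eq K (inv_jet a 1 ^+ n) (inv_jet a n).
Proof.
move=> a0; elim: n => [|n IH]; first by rewrite expr0 inv_jet0.
rewrite exprS IH -(inv_jetS n a0) mulrCA mulrA.
have -> : ('X + a%:P%:P) * inv_jet a 1 * inv_jet a n.+1 =
   (('X + a%:P%:P) * inv_jet a 1) * inv_jet a n.+1 by [].
by rewrite (inv_jet1 a0) mul1r.
Qed.

(** exp (2 x u), where x is the variable of the coefficients. *)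
Definition exp_jet : {poly {poly R}} :=
  \poly_(l < K) ((2 ^+ l / l`!%:R) *: 'X^l).

(** exp (- 2 a u - u^2), by the generating function of the Hermite
    polynomials. *)
Definition gauss_jet (a : R) : {poly {poly R}} :=
  \poly_(r < K) ((- 2) ^+ r / r`!%:R * (hermite R r).[a])%:P.

Lemma euler_exp_jet : jet_eq K (euler exp_jet) ('X * (2 * 'X)%:P * exp_jet).
Proof.
move=> k kK; rewrite coef_euler -mulrA coefXM coefCM !coef_poly kK.
case: k kK => [|k] kK /=; first by rewrite mulr0n.
rewrite (ltnW kK) -mulrA -scalerAr -exprS -scaler_nat -(polyC_natr R 2).
rewrite mul_polyC !scalerA; congr (_ *: _).
by rewrite factS natrM exprS; field; rewrite fact_neq0 nat1r pnatr_eq0.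
Qed.

Lemma euler_gauss_jet (a : R) :
  jet_eq K (euler (gauss_jet a))
    ('X * ((- 2 * a)%:P%:P - 2 * 'X) * gauss_jet a).
Proof.
move=> k kK; rewrite coef_euler -mulrA coefXM mulrBl coefB coefCM -mulrA.
rewrite -(polyC_natr {poly R} 2) -(polyC_natr R 2) coefCM coefXM !coef_poly kK.
case: k kK => [|k] kK /=; first by rewrite mulr0n.
rewrite (ltnW kK) -polyCM -polyCMn.
case: k kK => [|k] kK /=.
  rewrite mulr0 subr0; congr (_%:P).
  by rewrite hermite0 hermite1 hornerX hornerC; field.
rewrite (ltnW (ltnW kK)) -polyCM -polyCB; congr (_%:P).
rewrite hermite_rec hornerD hornerN hornerZ hornerM hornerX -[LHS]mulr_natr.
rewrite !factS !natrM !exprS; field.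
by rewrite fact_neq0 nat1r -natrD !pnatr_eq0.
Qed.

End ExplicitJets.

Lemma coef_prod_poly (S : comNzRingType) (T : finType) (K d : nat)
    (al : T -> nat -> S) (f : {poly S}) : (d < K)%N ->
  ((\prod_(q : T) \poly_(l < K) al q l) * f)`_d =
  \sum_(l : {ffun T -> 'I_d.+1} | (\sum_(q : T) l q <= d)%N)
     (\prod_(q : T) al q (l q)) * f`_(d - \sum_(q : T) l q).
Proof.
move=> dK.
have cut q : jet_eq d.+1 (\poly_(l < K) al q l)
    (\sum_(l < d.+1) al q l *: 'X^l).
  move=> k kd; rewrite -(poly_def d.+1 (al q)) !coef_poly kd.
  by rewrite (leq_trans kd dK).
have H : jet_eq d.+1 ((\prod_(q : T) \poly_(l < K) al q l) * f)
  ((\prod_(q : T) \sum_(l < d.+1) al q l *: 'X^l) * f).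
  by apply: jetM => //; apply: jet_prod => q _; apply: cut.
rewrite (H d) // bigA_distr_bigA /= mulr_suml coef_sum [RHS]big_mkcond /=.
apply: eq_bigr => l _; rewrite scaler_prod prodrXr -scalerAl coefZ coefXnM.
by rewrite ltnNge; case: leqP; rewrite ?mulr0.
Qed.

(** * The type I recurrence *)

Section TypeI.

Variables (R : realType) (p : nat) (hp : (0 < p)%N) (c : 'I_p -> R).
Hypothesis hc : injective c.
Variable i : 'I_p.

Definition typeI_scale : R := expR (- (c i ^+ 2 / 4)) / Num.sqrt pi.

(** The defining sum is the Cauchy product of the series above: l_i indexes the
    exponential, l_q the binomial series of the factor with exponent n_q, and
    d - sum_q l_q the Gaussian. *)
Lemma hermite_typeI_coef (K d : nat) (n : 'I_p -> nat) :
  n i = d.+1 -> (d < K)%N ->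
  hermite_typeI c i n = typeI_scale *:
   (exp_jet R K * gauss_jet K (c i / 2) *
    \prod_(q < p | q != i) inv_jet K ((c i - c q) / 2) 1 ^+ n q)`_d.
Proof.
move=> ni dK.
have ciq q : q != i -> c i - c q != 0.
  by move=> qi; rewrite subr_eq0; apply: contra qi => /eqP/hc->.
pose al q l : {poly R} := if q == i then (2 ^+ l / l`!%:R) *: 'X^l else
   ((-1) ^+ l * poch (n q)%:R l / l`!%:R / ((c i - c q) / 2) ^+ (n q + l))%:P.
have H : jet_eq K (exp_jet R K * gauss_jet K (c i / 2) *
    \prod_(q < p | q != i) inv_jet K ((c i - c q) / 2) 1 ^+ n q)
   ((\prod_(q < p) \poly_(l < K) al q l) * gauss_jet K (c i / 2)).
  rewrite mulrAC; apply: jetM => //; rewrite [X in jet_eq _ _ X](bigD1 i) //=.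
  apply: jetM; first by apply: jet_of_eq; rewrite /al eqxx.
  apply: jet_prod => q qi; rewrite inv_jet_exp.
    by apply: jet_of_eq; rewrite /al (negbTE qi).
  by rewrite mulf_neq0 ?ciq // invr_eq0 pnatr_eq0.
rewrite (H d dK) coef_prod_poly // /hermite_typeI ni !scaler_sumr.
apply: eq_bigr => l ld; rewrite coef_poly.
set s := (\sum_(q < p) l q)%N in ld *.
rewrite (leq_ltn_trans (leq_subr _ _) dK).
have alI k : al i k = (2 ^+ k / k`!%:R) *: 'X^k by rewrite /al eqxx.
have alQ q k : q != i -> al q k =
    ((-1) ^+ k * poch (n q)%:R k / k`!%:R / ((c i - c q) / 2) ^+ (n q + k))%:P.
  by rewrite /al => /negbTE ->.
rewrite [in RHS](bigD1 i) //= alI.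
under [in RHS]eq_bigr => q qi do rewrite alQ //.
rewrite -rmorph_prod /= -!scalerAl
  -[X in _ = _ *: (_ *: X)]mulrA -polyCM [_ * _%:P]mulrC mul_polyC !scalerA.
congr (_ *: _).
(* Only scalars are left; both sides are reduced to products over q != i. *)
have split2 (u : 'I_p -> nat) :
    (\sum_(q < p) u q = u i + \sum_(q < p | q != i) u q)%N.
  by rewrite (bigD1 i).
rewrite split2 ni addSn /=.
have -> : \prod_(q < p | q != i)
    ((-1) ^+ l q * poch (n q)%:R (l q) / (l q)`!%:R /
       ((c i - c q) / 2) ^+ (n q + l q))
  = 2 ^+ (\sum_(q < p | q != i) n q) * 2 ^+ (\sum_(q < p | q != i) l q) *
    (\prod_(q < p | q != i) (c i - c q) ^+ n q)^-1 *
    \prod_(q < p | q != i)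
       (poch (n q)%:R (l q) / ((l q)`!%:R * (c q - c i) ^+ l q)).
  rewrite -!prodrXr -prodfV -!big_split /=; apply: eq_bigr => q qi.
  have -> : c q - c i = -1 * (c i - c q) by ring.
  rewrite expr_div_n exprMn !exprD.
  have e : (-1 : R) ^+ l q = ((-1) ^+ l q)^-1 by rewrite -exprVn invrN1.
  rewrite {1}e; field.
  by rewrite !expf_neq0 ?ciq ?fact_neq0 ?oppr_eq0 ?oner_eq0 ?pnatr_eq0.
rewrite poch_opp_nat /typeI_scale.
have e1 : (d`!%:R : R) = (d ^_ s)%:R * (d - s)`!%:R.
  by rewrite -natrM ffact_fact.
have f0 : (d ^_ s)%:R != 0 :> R by rewrite pnatr_eq0 -lt0n ffact_gt0.
have e2 : (2 : R) ^+ d =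
    2 ^+ (d - s) * (2 ^+ l i * 2 ^+ (\sum_(q < p | q != i) l q)).
  by rewrite -!exprD -split2 subnK.
have e3 : (-1 : R) ^+ d = (-1) ^+ (d - s) * (-1) ^+ s by rewrite -exprD subnK.
have e4 : (-2 : R) ^+ (d - s) = (-1) ^+ (d - s) * 2 ^+ (d - s).
  by rewrite -exprMn mulN1r.
have e5 : (-1 : R) ^+ s * (-1) ^+ s = 1 by rewrite -exprMn mulrNN mulr1 expr1n.
rewrite exprD e1 e2 e3 e4.
rewrite -[RHS]mul1r -[X in _ = X * _]e5.
have pi0 : Num.sqrt (pi : R) != 0 by rewrite gt_eqF // sqrtr_gt0 pi_gt0.
move: (\prod_(q < p | q != i) (c i - c q) ^+ n q)^-1
  (\prod_(q < p | q != i) (_ / _)) => Q1 Q2.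
field.
by rewrite pi0 f0 !fact_neq0.
Qed.

Lemma count_cyclic_index (n : nat) :
  (\sum_(t < n) (cyclic_index hp t == i) = step_index p n i)%N.
Proof.
rewrite (sum_cyclic_index hp (fun q => (q == i : nat))) (bigD1 i) //= eqxx.
rewrite big1 ?addr0 ?natn // => q /negbTE ->; exact: mul0rn.
Qed.

Lemma step_index_leq (n : nat) : (step_index p n i <= n)%N.
Proof.
elim: n => [|n IH]; first by rewrite step_index0.
by rewrite (step_indexS hp) -addn1 leq_add // leq_b1.
Qed.

(** The residue representation.  It also covers n_i = 0, where u^M / P_n is
    divisible by u^M and the residue is zero. *)
Lemma stepA_coef (M n : nat) : (step_index p n i <= M)%N ->
  stepA c i n = typeI_scale *:
    ('X * (exp_jet R M.+1 * gauss_jet M.+1 (c i / 2)) *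
     pole_jet M (fun t => cyclic_index hp t == i)
       (fun t => inv_jet M.+1 (c i / 2 - node hp c t) 1) n)`_M.
Proof.
move=> nM; rewrite /pole_jet count_cyclic_index.
have -> : \prod_(t < n | cyclic_index hp t != i)
       inv_jet M.+1 (c i / 2 - node hp c t) 1
  = \prod_(q < p | q != i)
       inv_jet M.+1 ((c i - c q) / 2) 1 ^+ step_index p n q.
  rewrite big_mkcond (prod_cyclic_index hp (fun q => if q != i then
    inv_jet M.+1 (c i / 2 - c q / 2) 1 else 1)) [RHS]big_mkcond /=.
  by apply: eq_bigr => q _; rewrite mulrBl; case: ifP; rewrite ?expr1n.
rewrite -mulrA coefXM mulrCA coefXnM.
move Dd : (step_index p n i) nM => [|d] dM.
  rewrite /stepA /hermite_typeI Dd subn0; case: M dM => [|M] _ /=.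
    by rewrite scaler0.
  by rewrite ltnS leqnn scaler0.
case: M dM => // M dM; rewrite /= subSS ltnNge leq_subr /= subKn //.
by rewrite /stepA (hermite_typeI_coef (K := M.+2) Dd) //; apply: leq_trans dM _.
Qed.

Lemma stepA_rec (n : nat) : (1 <= n)%N ->
  'X * stepA c i n =
    stepA c i (n - 1)%N + rec_coef hp c 0 (n - 1)%N *: stepA c i n
    + \sum_(1 <= j < p.+1)
        rec_coef hp c j (n + j - 1)%N *: stepA c i (n + j)%N.
Proof.
case: n => // n _; rewrite subn1 /= rec_coef0.
(* Large enough for every pole order occurring in the recurrence. *)
pose M := (n.+1 + p)%N.
pose x t : {poly R} := (node hp c t)%:P.
pose I t := inv_jet M.+1 (c i / 2 - node hp c t) 1.
pose E := exp_jet R M.+1 * gauss_jet M.+1 (c i / 2).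
have hitP t : cyclic_index hp t == i -> x t = (c i / 2)%:P.
  by rewrite /x /node => /eqP ->.
have invP t : cyclic_index hp t != i ->
    jet_eq M.+1 (('X + ((c i / 2)%:P - x t)%:P) * I t) 1.
  move=> ti; rewrite /x -polyCB; apply: inv_jet1.
  rewrite /node -mulrBl mulf_neq0 ?invr_eq0 ?pnatr_eq0 // subr_eq0.
  by apply: contra ti => /eqP/hc ->.
have eulerE :
    jet_eq M.+1 (euler E) ('X * ((2 * ('X - (c i / 2)%:P))%:P - 2 * 'X) * E).
  rewrite /E eulerM euler_exp_jet euler_gauss_jet; apply: jet_of_eq.
  by rewrite mulNr !(polyCB, polyCM, polyCN, polyC_natr); ring.
have hM : (\sum_(t < n.+1 + p) (cyclic_index hp t == i) <= M)%N.
  by rewrite count_cyclic_index step_index_leq.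
have x0 t : \prod_(n.+1 <= s < n.+1 + p) (x t - x s) = 0.
  rewrite /x -[RHS](polyC0 R) -(prod_node_wide hp c t (leqnn (n.+1 + p))).
  by rewrite rmorph_prod; apply: eq_bigr => s _; rewrite rmorphB.
pose a (m : nat) : {poly R} :=
  ('X * E * pole_jet M (fun t => cyclic_index hp t == i) I m)`_M.
have rec : 2 * 'X * a n.+1 = 2 * (a n + x n * a n.+1)
    + \sum_(j < p) newton_weight x n.+1 (n.+1 + j) * a (n.+1 + j).+1.
  by have := residue_rec hitP invP eulerE hM x0; exact.
have A_a m : (m <= M)%N -> stepA c i m = typeI_scale *: a m.
  by move=> mM; apply: stepA_coef; apply: leq_trans (step_index_leq m) mM.
have half_rec : 'X * a n.+1 = a n + node hp c n *: a n.+1 +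
    \sum_(j < p) rec_coef hp c j.+1 (n.+1 + j) *: a (n.+1 + j).+1.
  have two : (2^-1)%:P * 2%:P = 1 :> {poly R}.
    by rewrite -polyCM mulVf ?pnatr_eq0.
  have weightE j : newton_weight x n.+1 (n.+1 + j)
      = (newton_weight (node hp c) n.+1 (n.+1 + j))%:P.
    rewrite /newton_weight rmorph_sum; apply: eq_bigr => t _.
    by rewrite rmorph_prod; apply: eq_bigr => s _; rewrite rmorphB.
  have -> : \sum_(j < p) rec_coef hp c j.+1 (n.+1 + j) *: a (n.+1 + j).+1 =
    (2^-1)%:P * \sum_(j < p) newton_weight x n.+1 (n.+1 + j) * a (n.+1 + j).+1.
    rewrite mulr_sumr; apply: eq_bigr => j _.
    rewrite weightE rec_coefE ?ltn_ord // mulrA -polyCM mul_polyC.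
    by rewrite subSS addnK.
  rewrite -mul_polyC -/(x n).
  have <- : (2^-1)%:P * (2 * 'X * a n.+1) = 'X * a n.+1.
    by rewrite -(polyC_natr R 2) !mulrA two mul1r.
  by rewrite rec mulrDr mulrA -(polyC_natr R 2) two mul1r.
have -> : \sum_(1 <= j < p.+1)
        rec_coef hp c j (n.+1 + j - 1)%N *: stepA c i (n.+1 + j)%N
  = typeI_scale *:
     \sum_(j < p) rec_coef hp c j.+1 (n.+1 + j) *: a (n.+1 + j).+1.
  rewrite big_add1 big_mkord scaler_sumr; apply: eq_bigr => j _.
  rewrite addnS subn1 /= A_a; last by rewrite /M -addnS leq_add2l ltn_ord.
  by rewrite !scalerA mulrC.
rewrite !A_a /M; try lia.
by rewrite -scalerAr half_rec !scalerDr !scalerA [typeI_scale * _]mulrC.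
Qed.

End TypeI.

Theorem corollary5p2 (R : realType) (p : nat) (hp : (0 < p)%N)
    (c : 'I_p -> R) (hc : injective c) :
  (forall n : nat,
     'X * stepB c n%:Z =
       stepB c (n%:Z + 1) + rec_coef hp c 0 n *: stepB c n%:Z
       + \sum_(1 <= j < p.+1) rec_coef hp c j n *: stepB c (n%:Z - j%:Z))
  /\
  (forall (n : nat) (i : 'I_p), (1 <= n)%N ->
     'X * stepA c i n =
       stepA c i (n - 1)%N + rec_coef hp c 0 (n - 1)%N *: stepA c i n
       + \sum_(1 <= j < p.+1)
           rec_coef hp c j (n + j - 1)%N *: stepA c i (n + j)%N).
Proof.
split=> [n | n i n1]; first exact: stepB_rec.
exact: stepA_rec.
Qed.
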